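(* Let $V$ be a finite-dimensional complex vector space and let $N$ be a non-zero nilpotent linear transformation on $V$. If $T\in \mathrm{Col}(N)$, then $TM=M$ for every hyperinvariant subspace $M$ of $N$; that is, $\mathrm{Col}(N)\subseteq \mathrm{Alg}\,\mathrm{Lat}\,(N)'$.
   Context: $\mathrm{Lat}(N)$ is the lattice of all subspaces $M\subseteq V$ with $NM\subseteq M$. $\mathrm{Col}(N)$ is the group of all invertible linear transformations $S$ on $V$ such that for every subspace $M$ of $V$ one has $M\in\mathrm{Lat}(N)\iff SM\in\mathrm{Lat}(N)$. $(N)'=\{T:\ TN=NT\}$ is the commutant of $N$; a subspace of $V$ invariant under every element of $(N)'$ is called hyperinvariant for $N$; $\mathrm{Lat}\,(N)'$ is the set of all hyperinvariant subspaces of $N$; and $\mathrm{Alg}\,\mathrm{Lat}\,(N)'$ is the algebra of all linear transformations $T$ on $V$ with $TM\subseteq M$ for every $M\in\mathrm{Lat}\,(N)'$. *)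

(* Defs.v *)
From mathcomp Require Import all_boot all_order all_algebra.
From mathcomp Require Import classical_sets.

Set Implicit Arguments.
Unset Strict Implicit.
Unset Printing Implicit Defensive.

Import GRing.Theory.

Local Open Scope ring_scope.

(* [V] has finite dimension, so [{vspace V}] is the type of all its subspaces. *)
Section InvariantSubspaces.
Context {K : fieldType} {V : vectType K}.
Implicit Types (N S T : 'End(V)) (F : set 'End(V)) (L : set {vspace V}).
Implicit Types M : {vspace V}.

(* The composition ring structure on ['End(V)] requires a nonzero [V], hence the
   iteration in place of [N ^+ k]. *)
Definition nilpotent_lfun N : Prop := exists k, forall v, iter k N v = 0.

Definition LatOf F : set {vspace V} :=
  [set M | forall T, F T -> (T @: M <= M)%VS].

Definition Lat N : set {vspace V} := [set M | (N @: M <= M)%VS].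

Definition Alg L : set 'End(V) :=
  [set T | forall M, L M -> (T @: M <= M)%VS].

Definition commutant N : set 'End(V) :=
  [set T | (T \o N)%VF = (N \o T)%VF].

Definition hyperinvariant N M : Prop := LatOf (commutant N) M.

Definition Col N : set 'End(V) :=
  [set S : 'End(V) | bijective S /\ forall M, Lat N M <-> Lat N (S @: M)%VS].

End InvariantSubspaces.

(* Main.v *)
(* The key is that [T], although it need not commute with [N], satisfies
   [T (N M) <= N (T M)] and [T (N^-1 M) <= N^-1 (T M)] for invariant [M]: these
   are the intersection of the invariant hyperplanes of [M], and the sum of the
   invariant subspaces in which [M] is a hyperplane. Hence [T] preserves every
   subspace [N^-k (N^j V)], which says that the height of [N^k (T v)] is at
   least that of [N^k v], for all [k] and [v]. As in Kaplansky's proof that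
   finite modules over a principal ideal domain are fully transitive, this
   yields a transformation commuting with [N] that sends [v] to [T v]. *)
Require Import Defs.
From HB Require Import structures.
From mathcomp Require Import all_boot all_order all_algebra.
From mathcomp Require Import classical_sets reals complex.
Import GRing.Theory.
Local Open Scope ring_scope.
Local Open Scope classical_set_scope.

Section Nilpotent.
Set Implicit Arguments.
Unset Strict Implicit.
Context {K : fieldType} {V : vectType K}.
Implicit Types (f g N T : 'End(V)) (A M U W : {vspace V}) (x y v w : V).

(** * Functionals and rank one maps *)

Lemma scalar_separation U x : x \notin U ->
  exists phi : 'Hom(V, K^o), phi x = 1 /\ forall u, u \in U -> phi u = 0.
Proof.
move=> xU; pose p := (\1 - projv U)%VF; pose X := [tuple p x].
have px0 : p x != 0.
  apply: contraNneq xU; rewrite add_lfunE opp_lfunE id_lfunE.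
  by move/subr0_eq=> ->; exact: memv_proj.
have fX : free X by rewrite free_cons /= nil_free span_nil memv0 px0.
have lin : linear (fun v => coord X ord0 (p v) : K^o).
  by move=> a u v; rewrite !linearP.
pose L := GRing.isLinear.Build K V K^o *:%R _ lin.
pose phi : {linear V -> K^o} := HB.pack (fun v => coord X ord0 (p v) : K^o) L.
exists (linfun phi); split=> [|u uU]; rewrite lfunE /=.
  by have := coord_free ord0 ord0 fX; rewrite eqxx.
by rewrite add_lfunE opp_lfunE id_lfunE projv_id // subrr linear0.
Qed.

Lemma rank1_lfun (phi : 'Hom(V, K^o)) z :
  exists g : 'End(V), forall v, g v = phi v *: z.
Proof.
have lin : linear (fun v => phi v *: z).
  by move=> a u v; rewrite linearP scalerDl scalerA.
pose L := GRing.isLinear.Build K V V *:%R (fun v => phi v *: z) lin.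
pose fL : {linear V -> V} := HB.pack (fun v => phi v *: z) L.
by exists (linfun fL) => v; rewrite lfunE.
Qed.

(** * Image powers and nilpotency *)

Lemma memv_iter_preim k N U v :
  (v \in iter k (fun W => (N @^-1: W)%VS) U) = (iter k N v \in U).
Proof.
by elim: k v => // k IH v; rewrite iterS -memv_preim IH -iterSr.
Qed.

(** This is [N^j V]; membership of a vector means that its height is at least [j]. *)
Notation im_pow N j := (iter j (fun W => (N @: W)%VS) fullv).

Lemma Lat_mem N M v : Lat N M -> v \in M -> N v \in M.
Proof. by move=> NM vM; apply: (subvP NM); exact: memv_img. Qed.

Lemma Lat_im_pow N j : Lat N (im_pow N j).
Proof. by elim: j => [|j IH]; [exact: subvf | exact: limgS]. Qed.

Lemma im_pow_anti N i j : (i <= j)%N -> (im_pow N j <= im_pow N i)%VS.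
Proof.
move=> /subnK <-; elim: (j - i)%N => // k IH; apply: subv_trans IH.
exact: Lat_im_pow.
Qed.

Lemma im_pow_nilpotent N : nilpotent_lfun N -> exists n, im_pow N n = 0%VS.
Proof.
move=> [n nN]; exists n; apply/eqP; rewrite -subv0; apply/subvP=> v.
suff H k u : u \in im_pow N k -> exists w, u = iter k N w.
  by move=> /H[w ->]; rewrite nN mem0v.
elim: k u => [|k IH] u; first by exists u.
by move=> /memv_imgP[u' /IH[w ->] ->]; exists w.
Qed.

(** Feeding the inclusion into itself gives [A <= W + N^k V] for every [k], and some [N^k V] is
    zero. *)
Lemma nilpotent_Nakayama N A W : nilpotent_lfun N -> Lat N W ->
  (A <= W + N @: A)%VS -> (A <= W)%VS.
Proof.
move=> /im_pow_nilpotent[n nN] NW AW.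
suff H k : (A <= W + im_pow N k)%VS by have := H n; rewrite nN addv0.
elim: k => [|k IH]; first exact: subv_trans (subvf _) (addvSr _ _).
apply: (subv_trans AW); rewrite subv_add addvSl /=.
apply: (subv_trans (limgS N IH)); rewrite limgD; exact: addvS.
Qed.

Lemma Lat_addv_line N A x : Lat N A -> N x \in A -> Lat N (A + <[x]>)%VS.
Proof.
move=> NA Nx; apply: subv_trans (addvSl _ _).
by rewrite limgD subv_add NA limg_line -memvE.
Qed.

(** * Action of a collineation on images, preimages and heights *)

Section Collineation.
Variables (N T : 'End(V)).
Hypotheses (nilN : nilpotent_lfun N) (TN : Col N T).

Lemma Col_inj : injective T.
Proof. by case: TN => /bij_inj. Qed.

Lemma Col_mem_img M v : (T v \in (T @: M)%VS) = (v \in M).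
Proof.
apply/idP/idP; last exact: memv_img.
by move=> /memv_imgP[u uM /Col_inj ->].
Qed.

Lemma Col_img_preim M : (T @: (T @^-1: M))%VS = M.
Proof.
apply/vspaceP=> v; case: TN => -[T' T'K TK] _.
by rewrite -[v]TK Col_mem_img memv_preim.
Qed.

(** If [v] in [N M] had [T v] outside [N (T M)], a functional killing [N (T M)] but not [T v] would
    cut out an invariant hyperplane [H] of [M] missing [v]. Since [v] spans [M] modulo [H],
    [M <= H + N M], and Nakayama forces [M <= H]. *)
Lemma Col_img M : Lat N M -> (T @: (N @: M) <= N @: (T @: M))%VS.
Proof.
move=> NM; have NTM : Lat N (T @: M)%VS by apply/(TN.2 M).
apply/subvP=> _ /memv_imgP[v vNM ->]; apply/negPn/negP=> vN.
have [phi [phi1 phi0]] := scalar_separation vN.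
pose H := (T @^-1: (T @: M :&: lker phi))%VS.
have HP u : (u \in H) = (u \in M) && (phi (T u) == 0).
  by rewrite -memv_preim memv_cap Col_mem_img memv_ker.
(* Any subspace of [T M] containing [N (T M)] is invariant; [Col N] transfers this from [T H] to
   [H]. *)
have NH : Lat N H.
  apply/(TN.2 H); rewrite /H Col_img_preim.
  apply/subvP=> _ /memv_imgP[u + ->]; rewrite memv_cap => /andP[uM _].
  by rewrite memv_cap Lat_mem //= memv_ker phi0 // memv_img.
suff MH : (M <= H)%VS.
  have := subvP MH v (subvP NM v vNM).
  by rewrite HP phi1 oner_eq0 andbF.
apply: (nilpotent_Nakayama nilN NH); apply/subvP=> m mM.
rewrite -(subrK (phi (T m) *: v) m) memv_add ?memvZ //.
rewrite HP memvB ?memvZ ?(subvP NM v) //=.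
by rewrite linearB linearZ linearB linearZ /= phi1 [X in _ - X]mulr1 subrr.
Qed.

Lemma Col_preim M : Lat N M -> (T @: (N @^-1: M) <= N @^-1: (T @: M))%VS.
Proof.
move=> NM; have NTM : Lat N (T @: M)%VS by apply/(TN.2 M).
apply/subvP=> _ /memv_imgP[v + ->]; rewrite -!memv_preim => NvM.
have /(TN.2 _) : Lat N (M + <[v]>)%VS by exact: Lat_addv_line.
rewrite limgD limg_line => NTMv.
have /memv_addP[m mM [_ /vlineP[c ->] NTv]] : N (T v) \in (T @: M + <[T v]>)%VS.
  by apply: (Lat_mem NTMv); rewrite (subvP (addvSr _ _)) ?memv_line.
have [c0|c0] := eqVneq c 0; first by rewrite NTv c0 scale0r addr0.
(* For [c] nonzero, [T v] lies in [T M + N <T v>], so Nakayama puts [T v] itself in [T M]. *)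
apply: (Lat_mem NTM); rewrite memvE.
apply: (nilpotent_Nakayama nilN NTM).
rewrite -memvE limg_line.
have Tv : T v = c^-1 *: (- m + N (T v)) by rewrite NTv addKr scalerK.
by rewrite [X in X \in _]Tv memvZ // memv_add ?memvN ?memv_line.
Qed.

Lemma Col_height k j v :
  iter k N v \in im_pow N j -> iter k N (T v) \in im_pow N j.
Proof.
have Tim i : (T @: im_pow N i <= im_pow N i)%VS.
  elim: i => [|i IH]; first exact: subvf.
  exact: subv_trans (Col_img (Lat_im_pow N i)) (limgS N IH).
rewrite -!memv_iter_preim.
suff [_ H] : Lat N (iter k (fun W => (N @^-1: W)%VS) (im_pow N j)) /\
  (T @: iter k (fun W => (N @^-1: W)%VS) (im_pow N j)
    <= iter k (fun W => (N @^-1: W)%VS) (im_pow N j))%VS.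
  by move=> vk; apply: (subvP H); exact: memv_img.
elim: k => [|k [NL TL]]; first by split; [exact: Lat_im_pow | exact: Tim].
split; first by apply/subvP=> _ /memv_imgP[u + ->];
  rewrite /= -!memv_preim; exact: Lat_mem.
exact: subv_trans (Col_preim NL) (lpreimS N TL).
Qed.

End Collineation.

(** * Extension of maps that do not lower heights *)

(** A partial homomorphism on [A], encoded as a total map whose values off [A] are ignored. Heights
    are taken in [V], not in [A]. *)
Definition height_hom N A f :=
  (forall a, a \in A -> f (N a) = N (f a)) /\
  (forall j a, a \in A -> a \in im_pow N j -> f a \in im_pow N j).

(* The last hypothesis says that [x] has maximal height in its coset [A + x]. *)
Lemma height_hom_extend1 N A f x y : Lat N A -> height_hom N A f ->
  x \notin A -> N x \in A -> N y = f (N x) ->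
  (forall j, x \in im_pow N j -> y \in im_pow N j) ->
  (forall j a, a \in A -> a + x \in im_pow N j -> x \in im_pow N j) ->
  exists g, [/\ height_hom N (A + <[x]>)%VS g,
    forall a, a \in A -> g a = f a & g x = y].
Proof.
move=> NA [fN fh] xA NxA Ny xy xmax.
have [phi [phi1 phi0]] := scalar_separation xA.
have [r rE] := rank1_lfun phi (y - f x).
(* The correction [r] vanishes on [A] and moves the value at [x] from [f x] to [y]. *)
pose g := f + r.
have gA a : a \in A -> g a = f a.
  by move=> aA; rewrite add_lfunE rE phi0 // scale0r addr0.
have gx : g x = y by rewrite add_lfunE rE phi1 scale1r addrC subrK.
exists g; split=> //; split=> [_|j _] /memv_addP[a aA [_ /vlineP[c ->] ->]].
  by rewrite !linearD !linearZ /= gx gA ?(Lat_mem NA) // (gA _ NxA) gA // fN // Ny.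
have [->|c0] := eqVneq c 0.
  by rewrite scale0r addr0 gA //; exact: fh.
move=> aj; rewrite linearD linearZ /= gx gA //.
(* Dividing by [c] puts an element of [A + x] in [N^j V], so maximality gives [x] height at least
   [j]; then [y] and [a] have it too. *)
have xj : x \in im_pow N j.
  apply: (xmax j (c^-1 *: a)); first exact: memvZ.
  by rewrite -[X in _ + X](scalerK c0) -scalerDr memvZ.
rewrite memvD ?memvZ ?xy //; apply: fh => //.
by rewrite -(addrK (c *: x) a) memvB ?memvZ.
Qed.

(** Induction on the codimension of [A], adjoining at each stage a vector [x] of maximal height in
    its coset. *)
Lemma height_hom_extend N A f : nilpotent_lfun N -> Lat N A ->
  height_hom N A f ->
  exists g, commutant N g /\ forall a, a \in A -> g a = f a.
Proof.
move=> nilN; have [n nN] := im_pow_nilpotent nilN.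
have [m] := ubnP (\dim {:V} - \dim A)%N.
elim: m => // m IH in A f * => Am NA hf.
have [AV|AV] := eqVneq A fullv.
  exists f; split=> //; apply/lfunP=> v; rewrite !comp_lfunE hf.1 //.
  by rewrite AV memvf.
pose P j := (im_pow N j :&: N @^-1: A <= A)%VS.
have exP : exists j, P j by exists n; rewrite /P nN cap0v sub0v.
(* Minimum 0 would mean [N^-1 A <= A], hence [A = V] by nilpotency. Otherwise the minimum is [j.+1],
   and failure of [P j] supplies [x]. *)
case: (ex_minnP exP) => -[|j] Pj jmin.
  case/eqP: AV; apply/vspaceP=> v; rewrite memvf.
  have pA u : N u \in A -> u \in A.
    by move=> Nu; apply: (subvP Pj); rewrite memv_cap memvf -memv_preim.
  have [k kN] := nilN; have : iter k N v \in A by rewrite kN mem0v.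
  by elim: k {kN} v => // k IHk v /=; move/pA/IHk.
have /subvPn[x] : ~~ P j by apply/negP=> /jmin; rewrite ltnn.
rewrite memv_cap -memv_preim => /andP[xj NxA] xA.
(* The gain of one in height lets [y] be chosen in [N^j V], matching the height of [x]. *)
have /memv_imgP[y yj Ny] : f (N x) \in im_pow N j.+1.
  by apply: hf.2 => //; exact: memv_img.
have xmax i a : a \in A -> a + x \in im_pow N i -> (i <= j)%N.
  move=> aA axi; rewrite leqNgt; apply/negP=> ji.
  have : a + x \in A.
    apply: (subvP Pj); rewrite memv_cap (subvP (im_pow_anti N ji)) //=.
    by rewrite -memv_preim linearD memvD // (Lat_mem NA).
  by rewrite rpredDl // (negPf xA).
have [|i a aA axi|g [hg gA gx]] := height_hom_extend1 NA hf xA NxA (esym Ny).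
- move=> i xi; apply: (subvP (im_pow_anti N _) _ yj).
  by apply: (xmax i 0); rewrite ?mem0v ?add0r.
- exact: (subvP (im_pow_anti N (xmax _ _ aA axi))).
have [||g' [g'N g'A]] := IH (A + <[x]>)%VS g _ _ hg.
- have dimA : (\dim A < \dim (A + <[x]>))%N.
    rewrite ltn_neqAle dimvS ?addvSl // andbT.
    apply: contra xA => /eqP dimA.
    have /eqP -> : (A == A + <[x]>)%VS by rewrite eqEdim addvSl -dimA leqnn.
    by rewrite (subvP (addvSr _ _)) ?memv_line.
  have dimB := dimvS (subvf (A + <[x]>)%VS).
  by rewrite (leq_trans (ltn_sub2l _ dimA)) // (leq_trans dimA).
- exact: Lat_addv_line.
exists g'; split=> // a aA; rewrite g'A ?gA //.
by rewrite (subvP (addvSl _ _)).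
Qed.

(** Induction on the order of [x]: the map sending [N x] to [N y] is extended by [x]. Minimality of
    [A] is carried along to obtain [A <= N B] below. *)
Lemma height_hom_cyclic N x y : nilpotent_lfun N ->
  (forall k j, iter k N x \in im_pow N j -> iter k N y \in im_pow N j) ->
  exists A f, [/\ Lat N A, x \in A,
    forall W, Lat N W -> x \in W -> (A <= W)%VS, height_hom N A f & f x = y].
Proof.
move=> nilN; have [n nN] := im_pow_nilpotent nilN.
have [m xm] : exists m, iter m N x = 0 by have [k kN] := nilN; exists k.
(* Zero has every height, so [z] lies in [N^n V = 0]. *)
have triv z : (forall j, 0 \in im_pow N j -> z \in im_pow N j) ->
  exists A f, [/\ Lat N A, 0 \in A,
    forall W, Lat N W -> 0 \in W -> (A <= W)%VS, height_hom N A f & f 0 = z].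
  move=> /(_ n (mem0v _)); rewrite nN memv0 => /eqP ->.
  exists 0%VS, (0 : 'End(V)); split; rewrite ?mem0v ?linear0 //.
  - by rewrite /Lat /= limg0 sub0v.
  by split=> [a _|j a _ _]; rewrite !zero_lfunE ?linear0 ?mem0v.
elim: m => [|m IH] in x y xm * => xy.
  by move: xm xy => /= -> xy; apply: triv => j; exact: (xy 0%N).
have [x0|x0] := eqVneq x 0.
  by rewrite x0 in xy *; apply: triv => j; exact: (xy 0%N).
rewrite iterSr in xm.
have [|A [f [NA NxA Amin hf fNx]]] := IH _ (N y) xm.
  by move=> k j; rewrite -!iterSr; exact: xy.
pose B := (A + <[x]>)%VS.
have xB : x \in B by rewrite (subvP (addvSr _ _)) ?memv_line.
have NB : Lat N B by exact: Lat_addv_line.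
have ANB : (A <= N @: B)%VS by apply: Amin; [exact: limgS | exact: memv_img].
(* As [a] lies in [N B], [B <= W + N B], and Nakayama gives [B <= W]. Taking [W = N^j V] shows that
   [x] has maximal height in [A + x]. *)
have xmem W a : Lat N W -> a \in A -> a + x \in W -> x \in W.
  move=> NW aA axW; apply: (subvP _ _ xB).
  apply: (nilpotent_Nakayama nilN NW).
  rewrite subv_add (subv_trans ANB (addvSr _ _)) /= -memvE.
  by rewrite -(addKr a x) addrC memv_add // memvN (subvP ANB).
(* Here [W = 0] and [a = - x]. *)
have xA : x \notin A.
  apply: contra x0 => xA; rewrite -memv0.
  apply: (xmem _ (- x)); rewrite ?memvN ?addNr ?mem0v //.
  by rewrite /Lat /= limg0 sub0v.
have [|j a aA|g [hg gA gx]] := height_hom_extend1 NA hf xA NxA (esym fNx).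
- exact: (xy 0%N).
- exact: xmem (Lat_im_pow N j) aA.
exists B, g; split=> // W NW xW; rewrite subv_add -memvE xW andbT.
by apply: Amin => //; exact: Lat_mem.
Qed.

Lemma full_transitivity N x y : nilpotent_lfun N ->
  (forall k j, iter k N x \in im_pow N j -> iter k N y \in im_pow N j) ->
  exists g, commutant N g /\ g x = y.
Proof.
move=> nilN /(height_hom_cyclic nilN)[A [f [NA xA _ hf <-]]].
have [g [gN gf]] := height_hom_extend nilN NA hf.
by exists g; split=> //; exact: gf.
Qed.

(** The commuting map [g] with [g v = T v] depends on [v], which suffices since [M] is invariant
    under all of them. *)
Lemma Col_hyperinvariant N T M : nilpotent_lfun N -> Col N T ->
  hyperinvariant N M -> (T @: M <= M)%VS.
Proof.
move=> nilN TN MN; apply/subvP=> _ /memv_imgP[v vM ->].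
have [g [gN <-]] := full_transitivity nilN (fun k j => @Col_height N T nilN TN k j v).
by apply: (subvP (MN g gN)); exact: memv_img.
Qed.

End Nilpotent.

Theorem proposition2 (R : realType) (V : vectType R[i]) (N : 'End(V))
    (N_neq0 : N <> 0) (N_nilp : nilpotent_lfun N) :
  (forall T : 'End(V), Col N T ->
     forall M : {vspace V}, hyperinvariant N M -> (T @: M)%VS = M) /\
  Col N `<=` Alg (LatOf (commutant N)).
Proof.
split=> [T TN M MN|T TN M MN]; last exact: Col_hyperinvariant MN.
(* Injectivity of [T] preserves dimension, turning the inclusion into an equality. *)
apply/eqP; rewrite eqEdim (Col_hyperinvariant N_nilp TN MN) /=.
rewrite limg_dim_eq //; apply/eqP; rewrite -subv0; apply/subvP=> v.
rewrite memv_cap memv_ker => /andP[_ /eqP Tv0]; rewrite memv0.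
by apply/eqP/(Col_inj TN); rewrite Tv0 linear0.
Qed.
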